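(* Let $d\ge 2$ be a prime power. There is a constant $c$ depending only on $d$ such that for every $n\ge 1$ and every pair-interaction Hamiltonian $H$ on $(\mathbb{C}^d)^{\otimes n}$ there exists a decoupling scheme for $H$ using $N$ local operations with $N\le c\,n$.
   Context: Let $\{\sigma_\alpha\mid\alpha=1,\dots,d^2-1\}$ be an orthogonal basis (trace inner product) of the real vector space of traceless Hermitian operators on $\mathbb{C}^d$, and let $\sigma^k_\alpha$ be the operator on $(\mathbb{C}^d)^{\otimes n}$ acting as $\sigma_\alpha$ on the $k$-th tensor factor (node) and as the identity elsewhere. A pair-interaction Hamiltonian is an operator $H=\sum_{k\ne l}\sum_{\alpha,\beta}J_{kl;\alpha\beta}\sigma^k_\alpha\sigma^l_\beta+\sum_{k}\sum_\alpha r_{k;\alpha}\sigma^k_\alpha$ with real coefficients and $J_{kl;\alpha\beta}=J_{lk;\beta\alpha}$. A unitary error basis of $\mathbb{C}^{d\times d}$ is a collection of $d^2$ unitary $d\times d$ matrices that are pairwise orthogonal with respect to the inner product $\langle A|B\rangle=\mathrm{tr}(A^\dagger B)/d$. A decoupling scheme for $H$ using $N$ local operations consists of unitary error bases $\mathcal{E}_k=\{E^k_i\mid i=1,\dots,d^2\}$, $k=1,\dots,n$, and an $n\times N$ matrix $M=(m_{kj})$ with entries in $\{1,\dots,d^2\}$ such that, with $U_j:=E^1_{m_{1j}}\otimes\cdots\otimes E^n_{m_{nj}}$, one has $\frac1N\sum_{j=1}^N U_j^\dagger HU_j=0$. *)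

(* Defs.v *)
From HB Require Import structures.
From mathcomp Require Import all_boot all_order all_algebra.
From mathcomp Require Import sesquilinear spectral.
From mathcomp Require Import reals complex.

Set Implicit Arguments.
Unset Strict Implicit.
Unset Printing Implicit Defensive.

Import Order.TTheory GRing.Theory Num.Theory.

Local Open Scope ring_scope.
Local Open Scope complex_scope.
Local Open Scope sesquilinear_scope.

(* The complex numbers are R[i] for an arbitrary R : realType. *)

Definition prime_power (d : nat) : Prop :=
  exists p k : nat, [/\ prime p, (0 < k)%N & d = (p ^ k)%N].

Definition trace_inner (R : realType) (d : nat) (A B : 'M[R[i]]_d) : R[i] :=
  \tr (A ^t* *m B).

Definition traceless_hermitian (R : realType) (d : nat) (A : 'M[R[i]]_d) :=
  A \is hermsymmx /\ \tr A = 0.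

(* The traceless Hermitian matrices form a vector space over R, not over R[i]:
   being a basis is unique expansion with coefficients in R. *)
Definition orthogonal_traceless_basis (R : realType) (d : nat)
    (sigma : 'I_(d ^ 2 - 1) -> 'M[R[i]]_d) : Prop :=
  [/\ forall a, traceless_hermitian (sigma a),
      forall A, traceless_hermitian A ->
        exists! x : {ffun 'I_(d ^ 2 - 1) -> R}, A = \sum_a (x a)%:C *: sigma a
    & forall a b, a != b -> trace_inner (sigma a) (sigma b) = 0].

(* The standard basis of the n-fold tensor power of C^d is indexed by
   {ffun 'I_n -> 'I_d}, so operators on it are square matrices of size
   #|{ffun 'I_n -> 'I_d}| = d ^ n. *)
Definition tensor_dim (d n : nat) : nat := #|{ffun 'I_n -> 'I_d}|.

Definition tensor_index (d n : nat) (x : 'I_(tensor_dim d n)) :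
    {ffun 'I_n -> 'I_d} := enum_val x.

Definition tensor_prod (R : realType) (d n : nat)
    (A : 'I_n -> 'M[R[i]]_d) : 'M[R[i]]_(tensor_dim d n) :=
  \matrix_(x, y) \prod_k A k (tensor_index x k) (tensor_index y k).

Definition on_node (R : realType) (d n : nat) (k : 'I_n) (A : 'M[R[i]]_d) :
    'M[R[i]]_(tensor_dim d n) :=
  tensor_prod (fun l => if l == k then A else 1%:M).

Definition pair_interaction_hamiltonian (R : realType) (d n : nat)
    (sigma : 'I_(d ^ 2 - 1) -> 'M[R[i]]_d)
    (H : 'M[R[i]]_(tensor_dim d n)) : Prop :=
  exists (J : 'I_n -> 'I_n -> 'I_(d ^ 2 - 1) -> 'I_(d ^ 2 - 1) -> R)
         (r : 'I_n -> 'I_(d ^ 2 - 1) -> R),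
    (forall k l a b, k != l -> J k l a b = J l k b a) /\
    H = \sum_k \sum_(l | k != l) \sum_a \sum_b
          (J k l a b)%:C *: (on_node k (sigma a) *m on_node l (sigma b))
        + \sum_k \sum_a (r k a)%:C *: on_node k (sigma a).

Definition unitary_error_basis (R : realType) (d : nat)
    (E : 'I_(d ^ 2) -> 'M[R[i]]_d) : Prop :=
  (forall i, E i \is unitarymx) /\
  (forall i j, i != j -> trace_inner (E i) (E j) / d%:R = 0).

(* Since 0^-1 = 0, the average below would vanish for N = 0 whatever H is;
   a scheme must use at least one local operation. *)
Definition decoupling_scheme (R : realType) (d n N : nat)
    (H : 'M[R[i]]_(tensor_dim d n))
    (E : 'I_n -> 'I_(d ^ 2) -> 'M[R[i]]_d)
    (M : 'M['I_(d ^ 2)]_(n, N)) : Prop :=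
  let U j := tensor_prod (fun k => E k (M k j)) in
  [/\ (0 < N)%N,
      forall k, unitary_error_basis (E k)
    & N%:R^-1 *: \sum_j ((U j) ^t* *m H *m U j) = 0].

(* Main.v *)
Require Import Defs.
From HB Require Import structures.
From mathcomp Require Import all_boot all_order all_algebra all_solvable all_field.
From mathcomp Require Import sesquilinear spectral.
From mathcomp Require Import reals complex.

Set Implicit Arguments.
Unset Strict Implicit.
Unset Printing Implicit Defensive.

Import GRing.Theory Num.Theory.

Local Open Scope ring_scope.
Local Open Scope sesquilinear_scope.

(**
  Use the same unitary error basis E on every node.  Completeness of E gives
  the twirl identity \sum_i E_i^* A E_i = d tr(A) 1, which kills traceless A.
  If the rows of the scheme form an orthogonal array of strength 2, then in
  the sum over its columns each local term, and each pair term, runs equally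
  often over all choices of basis elements at its one or two nodes, so it is
  a multiple of a twirl of a traceless matrix and vanishes.

  For the array, take a field F with q = d^2 elements (this is where d has to
  be a prime power): columns are the pairs (y0, y) in F x F^m, rows the vectors
  u in F^m, and the entry is y0 + <u, y>.  Two distinct rows are independent
  affine forms, whence strength 2.  With m the least integer such that
  n <= q^m, the number of columns q^(m+1) is at most q^2 n = d^4 n.  For the
  error basis, take the Weyl operators X^a Z^b.
*)

(** * Maps with fibres of equal size *)

Definition balanced (S T : finType) (h : S -> T) : Prop :=
  exists t, forall x, #|[pred s | h s == x]| = t.

Lemma sum_balanced (S T : finType) (h : S -> T) (V : nmodType) (f : T -> V) :
  balanced h -> exists t, \sum_s f (h s) = (\sum_x f x) *+ t.
Proof.
case=> t ht; exists t; rewrite (partition_big h xpredT) //= -sumrMnl.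
apply: eq_bigr => x _; rewrite -(ht x) -sumr_const.
by apply: eq_bigr => s /eqP ->.
Qed.

(** Used to relabel the columns and the symbols of an array over a field by ordinals. *)
Lemma balanced_bij (S S' T T' : finType) (h : S -> T) (g : T -> T')
    (g' : S' -> S) :
  bijective g -> bijective g' -> balanced h -> balanced (g \o h \o g').
Proof.
move=> [gi gK giK] bij_g' [t ht]; exists t => x; rewrite -(ht (gi x)).
rewrite -!sum1_card [RHS](reindex g') /=; last exact: onW_bij.
by apply: eq_bigl => s; rewrite !inE /= -(can_eq gK) giK.
Qed.

(** Joins the finite and the additive structure of a product, so that [balanced_additive] applies to
    maps into pairs. *)
HB.instance Definition _ (V W : finZmodType) := GRing.Zmodule.on (V * W)%type.

(** The fibres of a surjective homomorphism are the cosets of its kernel. *)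
Lemma balanced_additive (V W : finZmodType) (h : V -> W) :
  {morph h : x y / x + y} -> (forall w, exists v, h v = w) -> balanced h.
Proof.
move=> hD h_surj; exists #|[pred v | h v == 0]| => w.
have [v <-] := h_surj w; rewrite -!sum1_card (reindex_inj (addrI v)) /=.
by apply: eq_bigl => s; rewrite !inE hD -subr_eq0 addrAC subrr add0r.
Qed.

(** * Orthogonal arrays of strength 2 from affine forms *)

Definition orthogonal_array (q n N : nat) (M : 'M['I_q]_(n, N)) : Prop :=
  (forall k, balanced (fun j => M k j)) /\
  (forall k l, k != l -> balanced (fun j => (M k j, M l j))).

Section AffineArray.

Variables (F : finFieldType) (m : nat).

Definition affine_row (u : 'rV[F]_m) (y : F * 'rV[F]_m) : F :=
  y.1 + \sum_i u 0 i * y.2 0 i.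

Lemma affine_rowD u : {morph affine_row u : x y / x + y}.
Proof.
move=> x y; rewrite /affine_row /= addrACA -big_split /=.
by congr (_ + _); apply: eq_bigr => i _; rewrite mxE mulrDr.
Qed.

Lemma balanced_affine_row u : balanced (affine_row u).
Proof.
apply: balanced_additive; first exact: affine_rowD.
move=> a; exists (a, 0); rewrite /affine_row /= big1 ?addr0 // => i _.
by rewrite mxE mulr0.
Qed.

Lemma balanced_affine_row2 u v :
  u != v -> balanced (fun y => (affine_row u y, affine_row v y)).
Proof.
move=> neq_uv; apply: balanced_additive => [x y|[a b]].
  by rewrite !affine_rowD.
have /rV0Pn[i wi0] : v - u != 0 by rewrite subr_eq0 eq_sym.
(* For a column supported at a coordinate [i] where [u] and [v] differ, the two values differ by
   [(v - u) 0 i * c]. This [c] makes the difference [b - a]; the constant term then sets the first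
   value to [a]. *)
pose c := (b - a) / (v - u) 0 i.
have rowE w y0 : affine_row w (y0, c *: delta_mx 0 i) = y0 + w 0 i * c.
  rewrite /affine_row /= (bigD1 i) //= big1 => [|j jNi].
    by rewrite !mxE !eqxx mulr1 addr0.
  by rewrite !mxE (negPf jNi) andbF !mulr0.
exists (a - u 0 i * c, c *: delta_mx 0 i); rewrite !rowE subrK.
have -> : a - u 0 i * c + v 0 i * c = a + (v - u) 0 i * c.
  by rewrite !mxE mulrBl addrAC addrA.
by rewrite /c mulrC divfK // addrC subrK.
Qed.

End AffineArray.

Lemma orthogonal_array_exists (F : finFieldType) (q n : nat) :
  #|F| = q -> (0 < n)%N ->
  exists (N : nat) (M : 'M['I_q]_(n, N)),
    [/\ (0 < N)%N, (N <= q ^ 2 * n)%N & orthogonal_array M].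
Proof.
move=> cardF n_gt0; have q_gt1 : (1 < q)%N by rewrite -cardF finNzRing_gt1.
pose m := up_log q n; pose S := (F * 'rV[F]_m)%type.
have le_nS : (n <= #|{: 'rV[F]_m}|)%N by rewrite card_mx cardF mul1n up_logP.
pose u (k : 'I_n) : 'rV[F]_m := enum_val (widen_ord le_nS k).
have u_inj : injective u.
  by move=> k l /enum_val_inj /(congr1 val) /= /val_inj.
pose e (x : F) : 'I_q := cast_ord cardF (enum_rank x).
have e_bij : bijective e.
  apply: bij_comp (enum_rank_bij _).
  by exists (cast_ord (esym cardF)); [exact: cast_ordK | exact: cast_ordKV].
pose M : 'M['I_q]_(n, #|{: S}|) :=
  \matrix_(k, j) e (affine_row (u k) (enum_val j)).
have cardS : #|{: S}| = (q ^ m.+1)%N.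
  by rewrite card_prod card_mx cardF mul1n expnS.
exists #|{: S}|, M; split.
- by rewrite cardS expn_gt0 (ltnW q_gt1).
(* For [n > 1], minimality of [m] gives [q ^ m.-1 < n], which is multiplied by [q ^ 2]. For [n = 1],
   [m] is 0 and has no predecessor, so [q <= q ^ 2] is checked directly. *)
- rewrite cardS; have [n_le1|n_gt1] := leqP n 1.
    have -> : m = 0%N by apply/eqP; rewrite up_log_eq0 n_le1 orbT.
    have -> : n = 1%N by apply/eqP; rewrite eqn_leq n_le1.
    by rewrite muln1 leq_exp2l.
  have m_gt0 : (0 < m)%N by rewrite up_log_gt0 q_gt1.
  rewrite -(prednK m_gt0) -add2n expnD leq_pmul2l ?expn_gt0 ?(ltnW q_gt1) //.
  exact/ltnW/up_log_gtn.
- split=> [k|k l neq_kl].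
    have [t ht] := balanced_bij e_bij (@enum_val_bij S)
      (balanced_affine_row (u k)).
    by exists t => x; rewrite -(ht x); apply: eq_card => j; rewrite !inE mxE.
  have ee_bij : bijective (fun p : F * F => (e p.1, e p.2)).
    case: e_bij => g eK gK; exists (fun p => (g p.1, g p.2)) => [] [a b] /=.
      by rewrite !eK.
    by rewrite !gK.
  have neq_u : u k != u l by rewrite (inj_eq u_inj).
  have [t ht] := balanced_bij ee_bij (@enum_val_bij S)
    (balanced_affine_row2 neq_u).
  by exists t => x; rewrite -(ht x); apply: eq_card => j; rewrite !inE !mxE.
Qed.

(** * Roots of unity and Weyl operators *)

Lemma closed_field_prim_root (C : closedFieldType) (n : nat) :
  n%:R != 0 :> C -> exists w : C, n.-primitive_root w.
Proof.
move=> nz_n; have n_gt0 : (0 < n)%N.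
  by rewrite lt0n; apply: contraNneq nz_n => ->.
have [r] := closed_field_poly_normal ('X^n - 1 : {poly C}).
rewrite (monicP (monicXnsubC 1 n_gt0)) scale1r => Dr.
have rn1 : all n.-unity_root r.
  by apply/allP => z zr; rewrite /root_of_unity Dr root_prod_XsubC.
(* As [n] is nonzero in the field, X^n - 1 is separable: it has [n] distinct roots, and that many
   n-th roots of unity include a primitive one. *)
have r_uniq : uniq r by rewrite -separable_prod_XsubC -Dr separable_Xn_sub_1.
have sz_r : (n <= size r)%N.
  by rewrite -ltnS -(size_prod_XsubC r id) -Dr size_XnsubC.
by have /hasP[w _ w_prim] := has_prim_root n_gt0 rn1 r_uniq sz_r; exists w.
Qed.

Section Weyl.

Variables (R : realType) (d : nat).
Local Notation C := R[i]%C.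

Variable w : C.
Hypothesis w_prim : d.+1.-primitive_root w.

(** A diagonal phase matrix times a cyclic shift; the size is [d.+1] so that [x + a] is addition
    modulo the dimension. *)
Definition weyl (a b : 'I_d.+1) : 'M[C]_d.+1 :=
  \matrix_(x, y) ((y == x + a)%:R * w ^+ (b * x)).

Lemma conj_prim_root : w^* = w^-1.
Proof.
have norm_w : `|w| = 1.
  apply/eqP; rewrite -(@pexpr_eq1 _ _ d.+1) ?normr_ge0 //.
  by rewrite -normrX (prim_expr_order w_prim) normr1.
by rewrite invC_norm norm_w expr1n invr1 mul1r.
Qed.

Lemma conj_prim_rootX n : (w ^+ n)^* = w ^- n.
Proof. by rewrite rmorphXn /= conj_prim_root exprVn. Qed.

Lemma prim_root_neq0 : w != 0.
Proof.
apply: contra_eq_neq (prim_expr_order w_prim) => ->.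
by rewrite expr0n eq_sym oner_eq0.
Qed.

Lemma weyl_unitary a b : weyl a b \is unitarymx.
Proof.
apply/unitarymxP/matrixP => x z; rewrite !mxE (bigD1 (x + a)) //=.
rewrite big1 ?addr0 => [|y /negPf y_neq]; last first.
  by rewrite !mxE y_neq !mul0r.
rewrite !mxE eqxx mul1r (inj_eq (addIr a)) rmorphM /= rmorph_nat.
case: eqP => [<-|_]; last by rewrite mul0r mulr0.
by rewrite mul1r conj_prim_rootX divff // expf_neq0 ?prim_root_neq0.
Qed.

(** Different shifts have disjoint supports. For equal shifts the trace is a geometric sum whose
    ratio [z] is a root of unity other than 1; multiplied by [z - 1] it telescopes to 0. *)
Lemma weyl_orthogonal a b a' b' :
  (a, b) != (a', b') -> trace_inner (weyl a b) (weyl a' b') = 0.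
Proof.
move=> neq; rewrite /trace_inner /mxtrace.
under eq_bigr do rewrite mxE.
rewrite exchange_big /=.
have entryE (y : 'I_d.+1) :
  \sum_x ((weyl a b)^t*) x y * weyl a' b' y x =
    (a == a')%:R * (w ^+ b' / w ^+ b) ^+ y.
  rewrite (bigD1 (y + a)) //= big1 ?addr0 => [|x /negPf x_neq]; last first.
    by rewrite !mxE x_neq mul0r rmorph0 mul0r.
  rewrite !mxE eqxx mul1r conj_prim_rootX (inj_eq (addrI y)).
  by rewrite mulrCA expr_div_n -!exprM [_^-1 * _]mulrC.
under eq_bigr do rewrite entryE.
rewrite -mulr_sumr; move: neq; rewrite xpair_eqE.
case: (a == a') => /= neq; last by rewrite mul0r.
set z := w ^+ b' / w ^+ b; rewrite mul1r.
have z_neq1 : z - 1 != 0.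
  rewrite subr_eq0 (can2_eq (divfK _) (mulfK _)) ?expf_neq0 ?prim_root_neq0 //.
  by rewrite mul1r (eq_prim_root_expr w_prim) !modn_small // eq_sym.
apply: (mulfI z_neq1); rewrite mulr0 -subrX1.
rewrite expr_div_n -!exprM ![(_ * d.+1)%N]mulnC !exprM.
by rewrite (prim_expr_order w_prim) !expr1n divr1 subrr.
Qed.

End Weyl.

Lemma unitary_error_basis_exists (R : realType) (d : nat) :
  (0 < d)%N -> exists E : 'I_(d ^ 2) -> 'M[R[i]%C]_d, unitary_error_basis E.
Proof.
case: d => // d _.
have [|w w_prim] := @closed_field_prim_root R[i]%C d.+1.
  by rewrite pnatr_eq0.
have card_pair : #|{: 'I_d.+1 * 'I_d.+1}| = (d.+1 ^ 2)%N.
  by rewrite card_prod card_ord.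
pose p (i : 'I_(d.+1 ^ 2)) : 'I_d.+1 * 'I_d.+1 :=
  enum_val (cast_ord (esym card_pair) i).
exists (fun i => weyl w (p i).1 (p i).2); split=> [i|i j neq_ij].
  exact: weyl_unitary.
rewrite weyl_orthogonal ?mul0r // -!surjective_pairing.
by rewrite (inj_eq enum_val_inj) (inj_eq (@cast_ord_inj _ _ _)).
Qed.

(** * Completeness of error bases and the twirl identity *)

Section Twirl.

Variables (R : realType) (d : nat).
Local Notation C := R[i]%C.

(** The flattened basis matrices are the rows of a square matrix [G], and orthogonality says that G
    G^* is [d] times the identity. A one-sided inverse of a square matrix is two-sided, so G^* G is
    the same scalar matrix; its entries are the claim. *)
Lemma unitary_error_basis_complete (E : 'I_(d ^ 2) -> 'M[C]_d) a x b y :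
  unitary_error_basis E ->
  \sum_i (E i a x)^* * E i b y = (d%:R *+ (a == b)) *+ (x == y).
Proof.
move=> [E_unitary E_ortho].
have d_gt0 : (0 < d)%N := leq_ltn_trans (leq0n a) (ltn_ord a).
have nz_d : d%:R != 0 :> C by rewrite pnatr_eq0 -lt0n.
(* 'I_(d * d) and 'I_(d ^ 2) are convertible, so i also indexes E. *)
pose G : 'M[C]_(d * d) := \matrix_(i, j) mxvec (E i) 0 j.
have GG : G *m G^t* = d%:R%:M.
  apply/matrixP => i j; transitivity (trace_inner (E j) (E i)).
    rewrite /trace_inner /mxtrace !mxE.
    under [RHS]eq_bigr do rewrite mxE.
    rewrite (reindex _ (curry_mxvec_bij d d)) exchange_big pair_bigA /=.
    by apply: eq_bigr => [[u v]] _; rewrite !mxE !mxvecE mulrC.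
  rewrite [RHS]mxE; have [<-|neq_ij] := eqVneq i j.
    have /unitarymxP/mulmx1C := E_unitary i.
    by rewrite /trace_inner => ->; rewrite mxtrace1.
  move: neq_ij; rewrite eq_sym => /E_ortho /eqP.
  by rewrite mulf_eq0 invr_eq0 (negPf nz_d) orbF => /eqP.
have GG' : G^t* *m G = d%:R%:M.
  have /mulmx1C : G *m (d%:R^-1 *: G^t*) = 1%:M.
    by rewrite -scalemxAr GG scale_scalar_mx mulVf.
  move/(congr1 ( *:%R d%:R)); rewrite -scalemxAl scalerA divff // scale1r => ->.
  by rewrite scale_scalar_mx mulr1.
have /matrixP/(_ (mxvec_index a x) (mxvec_index b y)) := GG'.
have mxvec_inj : injective (uncurry (@mxvec_index d d)).
  have [g gK _] := curry_mxvec_bij d d.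
  by apply: (can_inj (g := g)) => p; apply: gK; rewrite inE.
rewrite !mxE (inj_eq mxvec_inj (a, x) (b, y)).
rewrite xpair_eqE -mulnb mulrnA => <-; apply: eq_bigr => i _.
by rewrite !mxE !mxvecE.
Qed.

Lemma unitary_error_basis_twirl (E : 'I_(d ^ 2) -> 'M[C]_d) (A : 'M[C]_d) :
  unitary_error_basis E ->
  \sum_i (E i)^t* *m A *m E i = (d%:R * \tr A)%:M.
Proof.
move=> ueb; apply/matrixP => x y; rewrite summxE.
(* With the sum over [i] innermost, completeness leaves only the diagonal entries of [A]. *)
transitivity (\sum_a \sum_b A a b * \sum_i (E i a x)^* * E i b y).
  under [RHS]eq_bigr do (under eq_bigr do rewrite mulr_sumr;
    rewrite exchange_big /=).
  rewrite [RHS]exchange_big /=; apply: eq_bigr => i _.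
  rewrite mxE [RHS]exchange_big /=; apply: eq_bigr => b _.
  rewrite mxE mulr_suml; apply: eq_bigr => a _.
  by rewrite !mxE mulrA [A a b * _]mulrC.
rewrite [RHS]mxE mulr_sumr -sumrMnl; apply: eq_bigr => a _.
under eq_bigr do rewrite unitary_error_basis_complete //.
rewrite (bigD1 a) //= big1 ?addr0 => [|b b_neq]; last first.
  by rewrite eq_sym (negPf b_neq) mulr0n mul0rn mulr0.
by rewrite eqxx mulr1n mulrnAr mulrC.
Qed.

End Twirl.

(** * Tensor products and conjugation of local operators *)

Section Tensor.

Variables (R : realType) (d n : nat).
Local Notation C := R[i]%C.
Implicit Types A B E : 'I_n -> 'M[C]_d.

Lemma eq_tensor_prod A B : A =1 B -> tensor_prod A = tensor_prod B.
Proof.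
move=> eqAB; apply/matrixP => x y; rewrite !mxE.
by apply: eq_bigr => k _; rewrite eqAB.
Qed.

Lemma tensor_prodM A B :
  tensor_prod A *m tensor_prod B = tensor_prod (fun k => A k *m B k).
Proof.
apply/matrixP => x y; rewrite !mxE.
under [RHS]eq_bigr do rewrite mxE.
(* A product over nodes of sums expands into a sum over functions from nodes to levels, which are
   the indices of the tensor basis. *)
rewrite bigA_distr_bigA [RHS](reindex _ (onW_bij _ (@enum_val_bij _))) /=.
by apply: eq_bigr => z _; rewrite !mxE -big_split.
Qed.

Lemma tensor_prod_adj A : (tensor_prod A)^t* = tensor_prod (fun k => (A k)^t*).
Proof.
apply/matrixP => x y; rewrite !mxE rmorph_prod.
by apply: eq_bigr => k _; rewrite !mxE.
Qed.

Lemma tensor_prod1 : tensor_prod (fun=> 1%:M) = 1%:M :> 'M[C]_(tensor_dim d n).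
Proof.
apply/matrixP => x y; rewrite !mxE; have [<-|neq_xy] := eqVneq x y.
  by rewrite big1 // => k _; rewrite mxE eqxx.
have /existsP[k neq_k] : [exists k, tensor_index x k != tensor_index y k].
  rewrite -negb_forall; apply: contra neq_xy => /forallP eq_xy.
  by apply/eqP/enum_val_inj/ffunP => k; apply/eqP/eq_xy.
by rewrite (bigD1 k) //= mxE (negPf neq_k) mul0r.
Qed.

Lemma on_node_sum (I : finType) (k : 'I_n) (A : I -> 'M[C]_d) :
  on_node k (\sum_i A i) = \sum_i on_node k (A i).
Proof.
apply/matrixP => x y; rewrite summxE !mxE (bigD1 k) //= eqxx summxE mulr_suml.
apply: eq_bigr => i _; rewrite mxE [RHS](bigD1 k) //= eqxx.
by congr (_ * _); apply: eq_bigr => l /negPf ->.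
Qed.

Lemma on_node0 (k : 'I_n) : on_node k 0 = 0 :> 'M[C]_(tensor_dim d n).
Proof.
by apply/matrixP => x y; rewrite !mxE (bigD1 k) //= eqxx mxE mul0r.
Qed.

Variables (E : 'I_n -> 'M[C]_d) (E_unitary : forall k, E k \is unitarymx).

Lemma tensor_prod_unitary : tensor_prod E \is unitarymx.
Proof.
apply/unitarymxP; rewrite tensor_prod_adj tensor_prodM -tensor_prod1.
by apply: eq_tensor_prod => k; apply/unitarymxP.
Qed.

(** At each node other than [k] the unitary meets its own adjoint and cancels. *)
Lemma on_node_conj k (A : 'M[C]_d) :
  (tensor_prod E)^t* *m on_node k A *m tensor_prod E =
  on_node k ((E k)^t* *m A *m E k).
Proof.
rewrite tensor_prod_adj !tensor_prodM; apply: eq_tensor_prod => l.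
case: eqP => [->//|_]; rewrite mulmx1.
by have /unitarymxP/mulmx1C := E_unitary l.
Qed.

(** Inserting U U^* = 1 between the two factors reduces this to one node at a time. *)
Lemma on_node2_conj k l (A B : 'M[C]_d) :
  (tensor_prod E)^t* *m (on_node k A *m on_node l B) *m tensor_prod E =
  on_node k ((E k)^t* *m A *m E k) *m on_node l ((E l)^t* *m B *m E l).
Proof.
rewrite -(on_node_conj k A) -(on_node_conj l B).
move: (tensor_prod E) (unitarymxP tensor_prod_unitary) => U UU.
by rewrite !mulmxA -[_ *m U *m U^t*]mulmxA UU mulmx1.
Qed.

End Tensor.

(** * Cancellation of local and pair terms *)

Section Decoupling.

Variables (R : realType) (d n N : nat).
Local Notation C := R[i]%C.
Variables (E : 'I_n -> 'I_(d ^ 2) -> 'M[C]_d) (M : 'M['I_(d ^ 2)]_(n, N)).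
Hypotheses (E_ueb : forall k, unitary_error_basis (E k)).
Hypothesis (M_oa : orthogonal_array M).

Definition scheme_sum (A : 'M[C]_(tensor_dim d n)) : 'M[C]_(tensor_dim d n) :=
  let U j := tensor_prod (fun k => E k (M k j)) in
  \sum_j (U j)^t* *m A *m U j.

Lemma scheme_sum_is_linear : linear scheme_sum.
Proof.
move=> c A B; rewrite /scheme_sum scaler_sumr -big_split; apply: eq_bigr => j _.
by rewrite mulmxDr mulmxDl -scalemxAr -scalemxAl.
Qed.

HB.instance Definition _ := GRing.isLinear.Build C _ _ _ scheme_sum
  scheme_sum_is_linear.

Let E_unitary k i : E k i \is unitarymx.
Proof. by case: (E_ueb k). Qed.

Let conj k i (A : 'M[C]_d) := (E k i)^t* *m A *m E k i.

Lemma on_node_twirl0 k (A : 'M[C]_d) :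
  \tr A = 0 -> \sum_i on_node k (conj k i A) = 0.
Proof.
move=> trA0; rewrite -on_node_sum unitary_error_basis_twirl // trA0 mulr0.
by rewrite raddf0 on_node0.
Qed.

Lemma scheme_sum_node k (A : 'M[C]_d) :
  \tr A = 0 -> scheme_sum (on_node k A) = 0.
Proof.
move=> trA0; rewrite /scheme_sum.
under eq_bigr => j _ do
  rewrite (on_node_conj (fun m => E_unitary m (M m j))).
have [t ->] := sum_balanced (fun i => on_node k (conj k i A)) (M_oa.1 k).
by rewrite on_node_twirl0 // mul0rn.
Qed.

Lemma scheme_sum_pair k l (A B : 'M[C]_d) :
  k != l -> \tr A = 0 -> scheme_sum (on_node k A *m on_node l B) = 0.
Proof.
move=> neq_kl trA0; rewrite /scheme_sum.
under eq_bigr => j _ do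
  rewrite (on_node2_conj (fun m => E_unitary m (M m j))).
pose f p := on_node k (conj k p.1 A) *m on_node l (conj l p.2 B).
have [t ->] := sum_balanced f (M_oa.2 k l neq_kl).
(* For each fixed choice [b] at node [l], the sum over choices at node [k] is the twirl of the
   traceless [A]. *)
rewrite -(pair_bigA _ (fun a b => f (a, b))) exchange_big /= big1 ?mul0rn //.
by move=> b _; rewrite /f /= -mulmx_suml on_node_twirl0 // mul0mx.
Qed.

End Decoupling.

Theorem corollary1 (d : nat) (d_ge2 : (2 <= d)%N) (d_pp : prime_power d) :
  exists c : nat,
    forall (R : realType) (n : nat), (1 <= n)%N ->
    forall sigma : 'I_(d ^ 2 - 1) -> 'M[R[i]%C]_d,
    orthogonal_traceless_basis sigma ->
    forall H : 'M[R[i]%C]_(tensor_dim d n),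
    pair_interaction_hamiltonian sigma H ->
    exists (N : nat) (E : 'I_n -> 'I_(d ^ 2) -> 'M[R[i]%C]_d)
           (M : 'M['I_(d ^ 2)]_(n, N)),
      decoupling_scheme H E M /\ (N <= c * n)%N.
Proof.
case: d_pp => p [e [p_prime e_gt0 d_pe]].
have e2_gt0 : (0 < e * 2)%N by rewrite muln_gt0 e_gt0.
(* The exponent is doubled to get d^2 field elements, one symbol for each member of an error
   basis. *)
have [F _ cardF] := pPrimePowerField p_prime e2_gt0.
rewrite expnM -d_pe in cardF.
exists ((d ^ 2) ^ 2)%N => R n n_gt0 sigma [sigma_th _ _] H [J [r [_ defH]]].
have [N [M [N_gt0 leN M_oa]]] := orthogonal_array_exists cardF n_gt0.
have [E0 E0_ueb] := unitary_error_basis_exists R (ltnW d_ge2).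
exists N, (fun=> E0), M; split=> //; split=> //.
have trs a : \tr (sigma a) = 0 by case: (sigma_th a).
suff sum0 : scheme_sum (fun=> E0) M H = 0 by rewrite [X in _ *: X]sum0 scaler0.
(* By linearity it suffices to annihilate each pair term and each local term. *)
rewrite defH linearD !linear_sum /= !big1 ?addr0 //.
  move=> k _; rewrite linear_sum big1 // => a _.
  by rewrite linearZ /= scheme_sum_node ?scaler0.
move=> k _; rewrite linear_sum big1 // => l neq_kl.
rewrite linear_sum big1 // => a _; rewrite linear_sum big1 // => b _.
by rewrite linearZ /= scheme_sum_pair ?scaler0.
Qed.
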